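(* For each integer $n \le 22$, let $N(n)$ denote the number of isomorphism classes of semi-equivelar maps of type $\{3^{3},4^{2}\}$ on the torus with exactly $n$ vertices. Then $N(10)=1$, $N(12)=3$, $N(14)=2$, $N(16)=5$, $N(18)=5$, $N(20)=6$, $N(22)=4$, and $N(n)=0$ for every other $n\le 22$.
   Context: A map on the torus is an embedding of a finite simple graph on the torus such that the closure of each connected component of the complement of the graph (a face) is a closed 2-cell; a face with $p$ vertices is a $p$-gon. A map is semi-equivelar of type $\{3^{3},4^{2}\}$ if at every vertex $v$ the faces incident with $v$, read in cyclic order around $v$, are three triangles followed by two quadrilaterals (cyclic sequence $(3,3,3,4,4)$). Two maps are isomorphic if there is a bijection between their vertex sets that maps the vertex sets of faces of one map exactly onto the vertex sets of faces of the other (equivalently, a homeomorphism of the torus carrying vertices, edges and faces of one map to those of the other, preserving incidences).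
   Formalization: Maps are additionally required to be polyhedral: two distinct faces meet in nothing, one vertex or one common edge. Without this the counts fail: K6 embeds on the torus with type {3^3,4^2}, so N(6) would not be 0. *)

(* Defs.v *)
From HB Require Import structures.
From mathcomp Require Import all_boot fingroup perm.

Set Implicit Arguments.
Unset Strict Implicit.
Unset Printing Implicit Defensive.

(* Cellular embeddings of a simple graph in closed oriented surfaces are given *)
(* by rotation systems (Heffter-Edmonds): each vertex v carries the cyclic     *)
(* order vrot v in which its neighbours appear around v.                        *)
Record embedding (V : finType) := Embedding {
  nbhd : {ffun V -> {set V}};
  vrot : {ffun V -> {perm V}}
}.

Section EmbeddingFinType.
Variable V : finType.

Definition pair_of_embedding (M : embedding V) := (nbhd M, vrot M).
Definition embedding_of_pair (p : {ffun V -> {set V}} * {ffun V -> {perm V}}) :=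
  Embedding p.1 p.2.

Lemma pair_of_embeddingK : cancel pair_of_embedding embedding_of_pair.
Proof. by case. Qed.

HB.instance Definition _ := Finite.copy (embedding V)
  (can_type pair_of_embeddingK).
End EmbeddingFinType.

Section Maps.
Variable V : finType.
Implicit Types (M : embedding V) (D F G : {set V * V}).

Definition adj M : rel V := [rel u v | v \in nbhd M u].

Definition simple_graph M : bool :=
  [forall u, forall v, adj M u v == adj M v u] && [forall v, ~~ adj M v v].

(* vrot M v is trivial outside nbhd M v (which makes the encoding unique) and   *)
(* permutes nbhd M v in a single cycle.                                        *)
Definition is_rotation M : bool :=
  [forall v, perm_on (nbhd M v) (vrot M v) &&
             [forall u in nbhd M v, porbit (vrot M v) u == nbhd M v]].

Definition connected_graph M : bool := n_comp (adj M) predT == 1.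

Definition darts M : {set V * V} := [set d | adj M d.1 d.2].

Definition verts_of D : {set V} := [set d.1 | d in D].
Definition edges_of D : {set {set V}} := [set [set d.1; d.2] | d in D].

(* Face tracing: a walk reaching v from u continues to the neighbour that      *)
(* follows u around v; faces are the resulting closed walks, as dart sets.     *)
Definition face_step M (d : V * V) : V * V := (d.2, vrot M d.2 d.1).
Definition face_of M (d : V * V) : {set V * V} :=
  [set d' | fconnect (face_step M) d d'].
Definition faces M : {set {set V * V}} := [set face_of M d | d in darts M].

(* The closure of a face is a closed disc iff its boundary walk is a cycle of  *)
(* the graph, i.e. has no repeated vertex.                                     *)
Definition closed_cell_faces M : bool :=
  [forall F in faces M, (2 < #|F|) && (#|verts_of F| == #|F|)].

(* Two distinct faces meet in nothing, a vertex or an edge. This has to be     *)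
(* required explicitly: K6 has a toroidal embedding of type (3,3,3,4,4) with   *)
(* closed disc faces in which a triangle meets a quadrangle in two opposite    *)
(* vertices of the latter.                                                     *)
Definition polyhedral M : bool :=
  [forall F in faces M, forall G in faces M, (F != G) ==>
     ((#|verts_of F :&: verts_of G| <= 1) ||
      (verts_of F :&: verts_of G \in edges_of F :&: edges_of G))].

(* The torus is the closed connected orientable surface with V - E + F = 0.    *)
Definition euler_zero M : bool :=
  #|V| + #|faces M| == #|edges_of (darts M)|.

Definition torus_map M : bool :=
  [&& simple_graph M, is_rotation M, connected_graph M, closed_cell_faces M,
      polyhedral M & euler_zero M].

(* Numbers of vertices of the faces around v, in the cyclic order of vrot M v,  *)
(* starting at the corner preceding the edge from v to u.                      *)
Definition face_sizes M (v u : V) : seq nat :=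
  [seq #|verts_of (face_of M (v, w))| | w <- orbit (vrot M v) u].

Definition semi_equivelar (s : seq nat) M : bool :=
  [forall v, exists u in nbhd M v,
     (face_sizes M v u == s) || (face_sizes M v u == rev s)].

Definition face_vertex_sets M : {set {set V}} := [set verts_of F | F in faces M].

Definition isomorphic M1 M2 : bool :=
  [exists f : {perm V},
     [set f @: A | A : {set V} in face_vertex_sets M1] == face_vertex_sets M2].

Lemma isomorphic_refl : reflexive isomorphic.
Proof.
move=> M; apply/existsP; exists 1%g; apply/eqP.
rewrite -[RHS]imset_id; apply: eq_imset => A.
by rewrite -[RHS]imset_id; apply: eq_imset => x; rewrite perm1.
Qed.

Lemma isomorphic_sym : symmetric isomorphic.
Proof.
suff H M1 M2 : isomorphic M1 M2 -> isomorphic M2 M1.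
  by move=> M1 M2; apply/idP/idP; apply: H.
case/existsP=> f /eqP E12; apply/existsP; exists f^-1%g; apply/eqP.
rewrite -E12 -imset_comp -[RHS]imset_id; apply: eq_imset => A /=.
by rewrite -imset_comp -[RHS]imset_id; apply: eq_imset => x /=; rewrite permK.
Qed.

Lemma isomorphic_trans : transitive isomorphic.
Proof.
move=> M2 M1 M3 /existsP[f /eqP E12] /existsP[g /eqP E23].
apply/existsP; exists (f * g)%g; apply/eqP; rewrite -E23 -E12 -[RHS]imset_comp.
apply: eq_imset => A /=; rewrite -[RHS]imset_comp.
by apply: eq_imset => x /=; rewrite permM.
Qed.

End Maps.

Definition num_classes (s : seq nat) (n : nat) : nat :=
  #|equivalence_partition (@isomorphic 'I_n)
      [set M : embedding 'I_n | torus_map M && semi_equivelar s M]|.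

(* Main.v *)
(* Around every vertex of a map of type (3,3,3,4,4) there is exactly one edge x
   between two quadrangles. Reading the other spokes from it, one obtains
   permutations a (one step along the strip), x and b (a step across a strip of
   quadrangles and a strip of triangles) with x^2 = 1, ab = ba, and x inverting
   a and b: they generate the group p2 of translations and half turns of the
   elongated triangular tiling, which acts transitively on the vertices. Half
   turns fix no vertex, so the map is the quotient of the tiling by a lattice,
   given by a^r = 1, b^s = a^k with 2rs vertices. A vertex of a triangle is
   not opposite to another one in a quadrangle, which leaves r > 2 and, if
   s = 1, 1 < k < r - 2. The reflection (a, b) -> (a^-1, ab) identifies k with
   -k-s modulo r; all other lattices are told apart by the numbers of closed
   walks crossing prescribed kinds of edges. *)
Require Import Defs.
From mathcomp Require Import all_boot fingroup perm zmodp cyclic zify.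

Set Implicit Arguments.
Unset Strict Implicit.
Unset Printing Implicit Defensive.

(** * The frames at the vertices *)

Section StripActions.
Variable V : finType.
Implicit Types (a b x : {perm V}) (F : {set {set V}}).

Definition quad a x v : {set V} := [set v; a v; x v; x (a v)].
Definition triangle a b x v : {set V} := [set v; a v; b (x v)].

(* [a] moves one step along the strip of [v], [x] crosses the quadrangle side
   at [v] and [b] crosses a strip of quadrangles and one of triangles, all read
   in a frame at [v] that a half turn carries to the frame at [x v]. The
   neighbours of [v] are [x v], [a v], [b (x v)], [a (b (x v))], [a^-1 v] in
   rotation order. *)
Record strip_action F a b x : Prop := StripAction {
  strip_faces : F = [set quad a x v | v : V] :|: [set triangle a b x v | v : V];
  strip_xx : forall v, x (x v) = v;
  strip_ab : forall v, a (b v) = b (a v);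
  strip_xaxa : forall v, x (a (x (a v))) = v;
  strip_xbxb : forall v, x (b (x (b v))) = v;
  strip_trans : forall A : pred V,
    (forall v, A v -> [/\ A (a v), A (b v) & A (x v)]) ->
    forall v w, A v -> A w;
  (* Up to conjugation, [x], [a * x], [b * x] and [a * b * x] are all the half
     turns. *)
  strip_half_turns : forall v,
    [/\ x v <> v, x v <> a v, x v <> b v & x v <> a (b v)];
  (* The last two clauses come from the polyhedrality of the map, the others
     from the distinctness of the neighbours. *)
  strip_shifts : forall v, [/\ a (a v) <> v, b v <> v, a (b v) <> v, b v <> a v
    & a (a (b v)) <> v]
}.
End StripActions.

(** * Faces and rotations of a torus map, traced from its darts *)

Section LocalStructure.
Variables (V : finType) (M : embedding V).
Hypotheses (tM : torus_map M) (sM : semi_equivelar [:: 3; 3; 3; 4; 4] M).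

Local Notation rot := (vrot M).
Local Notation nb := (nbhd M).
Local Notation step := (face_step M).
Local Notation csize v w := #|verts_of (face_of M (v, w))|.

Lemma nbhd_sym u v : (v \in nb u) = (u \in nb v).
Proof.
by case/andP: tM => /andP[/forallP/(_ u)/forallP/(_ v)/eqP].
Qed.

Lemma nbhd_irr v : v \notin nb v.
Proof. by case/andP: tM => /andP[_ /forallP/(_ v)]. Qed.

Lemma rot_nbhd v u : (rot v u \in nb v) = (u \in nb v).
Proof.
by case/and3P: tM => _ /forallP/(_ v)/andP[/perm_closed].
Qed.

Lemma porbit_rot v u : u \in nb v -> porbit (rot v) u = nb v.
Proof.
case/and3P: tM => _ /forallP/(_ v)/andP[_ /forall_inP/(_ u) H] _ uv.
by apply/eqP/H.
Qed.

Lemma map_connect u v : connect (adj M) u v.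
Proof.
have symM : connect_sym (adj M).
  by apply: sym_connect_sym => p q; rewrite /adj /= nbhd_sym.
have /and3P[_ _ /andP[+ _]] := tM.
rewrite /connected_graph /n_comp_mem => /card1P[w Hw].
have R z : root (adj M) z = w.
  apply/eqP; have := Hw (root (adj M) z).
  by rewrite !inE roots_root // => <-.
by rewrite -(root_connect symM) !R.
Qed.

Lemma face_step_inj : injective step.
Proof. by case=> u v [u' v'] [-> /perm_inj ->]. Qed.

Lemma face_of_step d : face_of M (step d) = face_of M d.
Proof.
by apply/setP=> d'; rewrite !inE -(same_fconnect1 face_step_inj).
Qed.

Lemma face_of_mem d d' : d' \in face_of M d -> face_of M d' = face_of M d.
Proof.
rewrite inE => dd'; apply/setP=> z; rewrite !inE.
by rewrite (same_connect (fconnect_sym face_step_inj) dd').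
Qed.

Lemma csize_step v w : csize v w = csize w (rot w v).
Proof. by rewrite -(face_of_step (v, w)). Qed.

Lemma face_of_faces v w : w \in nb v -> face_of M (v, w) \in faces M.
Proof. by move=> vw; apply: imset_f; rewrite inE. Qed.

Lemma csize_card v w : w \in nb v -> csize v w = #|face_of M (v, w)|.
Proof.
move=> /face_of_faces vw; case/and5P: tM => _ _ _ /forall_inP/(_ _ vw).
by case/andP=> _ /eqP.
Qed.

Lemma csize_iter v w : w \in nb v -> iter (csize v w) step (v, w) = (v, w).
Proof.
move=> vw; rewrite csize_card // -[RHS](iter_order face_step_inj).
congr iter; apply: eq_card => d; by rewrite inE.
Qed.

(** [csize v w] measures the corner preceding the spoke [w], so the two leading 4s put the first
    spoke between the two quadrangles. *)
Lemma frame_exists v : exists w : V, let s := traject (rot v) w 5 in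
  [/\ nb v =i s, uniq s, iter 5 (rot v) w = w &
      [seq csize v u | u <- s] = [:: 4; 4; 3; 3; 3]].
Proof.
move/forallP/(_ v)/exists_inP: sM => [u uv Hu].
have sz : fingraph.order (rot v) u = 5.
  rewrite -size_orbit -(size_map (fun w => csize v w)).
  by case/orP: Hu => /eqP; rewrite /face_sizes => ->.
have card5 : #|nb v| = 5.
  rewrite -(porbit_rot uv) -sz; apply: eq_card => y.
  apply/porbitP/idP => [[i ->]|/iter_findex <-].
    by rewrite permX; apply: fconnect_iter.
  by exists (findex (rot v) u y); rewrite permX.
have nbE w : w \in nb v -> nb v =i traject (rot v) w 5.
  by move=> wv z; rewrite -(porbit_rot wv) porbit_traject porbit_rot // card5.
have it5 w : w \in nb v -> iter 5 (rot v) w = w.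
  by move=> wv; have := iter_porbit (rot v) w; rewrite porbit_rot // card5.
have uniq5 w : w \in nb v -> uniq (traject (rot v) w 5).
  move=> wv; have := uniq_traject_porbit (rot v) w.
  by rewrite porbit_rot // card5.
have orb : orbit (rot v) u = traject (rot v) u 5 by rewrite /orbit sz.
case/orP: Hu; rewrite /face_sizes orb => /eqP Hu; last by exists u; split; auto.
(* From [u] the sizes read 3, 3, 3, 4, 4; three turns lead to the edge between the quadrangles. *)
have wv : iter 3 (rot v) u \in nb v by rewrite /= !rot_nbhd.
exists (iter 3 (rot v) u); split; auto.
move: Hu (it5 _ uv); rewrite /= => -[c0 c1 c2 c3 c4] it.
by rewrite !it c0 c1 c2 c3 c4.
Qed.

Lemma verts_face v w : w \in nb v ->
  verts_of (face_of M (v, w)) =i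
    [seq d.1 | d <- traject step (v, w) (csize v w)].
Proof.
move=> vw z; have tr d : (d \in face_of M (v, w)) =
    (d \in traject step (v, w) (csize v w)).
  rewrite csize_card // inE fconnect_orbit /orbit; congr (_ \in traject _ _ _).
  by apply: eq_card => d'; rewrite !inE.
by apply/imsetP/mapP=> -[d dd ->]; exists d; rewrite ?tr // -tr.
Qed.

(* The two faces along [vw] are triangles and meet a quadrangle at most in an
   edge of both, so no quadrangle contains [v] and [w]. *)
Lemma quad_triangle_edge v w F : w \in nb v -> F \in faces M ->
  #|F| = 4 -> csize v w = 3 -> csize w v = 3 ->
  v \in verts_of F -> w \in verts_of F -> False.
Proof.
move=> vw FM F4 c3 c3' vF wF.
have wv : v \in nb w by rewrite nbhd_sym.
have virr : v != w.
  by apply: contraL vw => /eqP->; apply: nbhd_irr.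
have TM := face_of_faces vw.
have := tM => /and5P[_ _ _ _ /andP[polyM _]].
have := forall_inP (forall_inP polyM _ TM) _ FM.
have TF : face_of M (v, w) != F.
  by apply/eqP=> TF; move: (csize_card vw); rewrite c3 TF F4.
rewrite TF /= => H.
have vT : v \in verts_of (face_of M (v, w)).
  by rewrite verts_face // c3 inE eqxx.
have wT : w \in verts_of (face_of M (v, w)).
  by rewrite verts_face // c3 !inE eqxx orbT.
have sub : [set v; w] \subset verts_of (face_of M (v, w)) :&: verts_of F.
  by apply/subsetP=> z; rewrite !inE => /orP[]/eqP->; apply/andP.
case/orP: H => [|/setIP[_]].
  by move/(leq_trans (subset_leq_card sub)); rewrite cards2 virr.
case/imsetP=> d dF E; move: sub; rewrite E => /subsetP sub.
have fF : face_of M d = F.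
  by case/imsetP: FM dF => d' _ -> /face_of_mem.
(* The common edge can only be that of [v] and [w], both of whose darts lie on triangles, whereas
   [d] lies on [F]. *)
have c4 : csize d.1 d.2 = 3.
  have := sub v; have := sub w; rewrite !inE !eqxx orbT.
  move=> /(_ isT) wd /(_ isT) vd.
  case/orP: vd => /eqP vd; case/orP: wd => /eqP wd.
  - by move: virr; rewrite vd wd eqxx.
  - by rewrite -vd -wd.
  - by rewrite -vd -wd.
  - by move: virr; rewrite vd wd eqxx.
move: c4; rewrite -surjective_pairing fF.
by have /and5P[_ _ _ /forall_inP/(_ _ FM)/andP[_ /eqP->] _] := tM; rewrite F4.
Qed.

(** * Fitting together the frames of adjacent vertices *)

Section Frame.
Variable e0 : V -> V.
Hypothesis frame : forall v, let s := traject (rot v) (e0 v) 5 in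
  [/\ nb v =i s, uniq s, iter 5 (rot v) (e0 v) = e0 v &
      [seq csize v u | u <- s] = [:: 4; 4; 3; 3; 3]].

Definition spoke i v := iter i (rot v) (e0 v).
Local Notation e := spoke.

Lemma spoke_nbhd i v : e i v \in nb v.
Proof.
elim: i => [|i IH]; rewrite /= ?rot_nbhd //.
by case: (frame v) => -> _ _ _; rewrite inE eqxx.
Qed.

Lemma spoke5 v : e 5 v = e 0 v.
Proof. by case: (frame v). Qed.

Lemma spoke_uniq v i j : i < 5 -> j < 5 -> e i v = e j v -> i = j.
Proof.
move=> i5 j5; case: (frame v) => _ U _ _ E; apply/eqP.
by rewrite -(nth_uniq (e0 v) _ _ U) ?size_traject // !nth_traject //; apply/eqP.
Qed.

(** The sixth entry repeats the first, as spoke 5 is spoke 0; this allows [i.+1] below without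
    reduction modulo 5. *)
Lemma spoke_csize i v : i <= 5 ->
  csize v (e i v) = nth 0 [:: 4; 4; 3; 3; 3; 4] i.
Proof.
rewrite leq_eqVlt => /orP[/eqP->|i5].
  by rewrite spoke5; case: (frame v) => _ _ _ [].
case: (frame v) => _ _ _ /= [].
by case: i i5 => [|[|[|[|[|//]]]]].
Qed.

Lemma spokeP v w : w \in nb v -> exists2 i, i < 5 & w = e i v.
Proof.
case: (frame v) => -> _ _ _ /(nthP (e0 v)) [i]; rewrite size_traject => i5.
by rewrite nth_traject // => <-; exists i.
Qed.

(** The face before an edge at one end is the face after it at the other. The sizes determine [j] if
    [i] is 0, 1 or 4, but leave 2 and 3 open for an edge between triangles. *)
Lemma spoke_rev i v : i < 5 -> exists j, [/\ j < 5, v = e j (e i v),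
  nth 0 [:: 4; 4; 3; 3; 3; 4] j = nth 0 [:: 4; 4; 3; 3; 3; 4] i.+1 &
  nth 0 [:: 4; 4; 3; 3; 3; 4] i = nth 0 [:: 4; 4; 3; 3; 3; 4] j.+1].
Proof.
move=> i5; have := spoke_nbhd i v; rewrite nbhd_sym => /spokeP[j j5 E].
exists j; split=> //.
  have <- := @spoke_csize j (e i v) (ltnW j5).
  by have <- := @spoke_csize i.+1 v i5; rewrite -E csize_step.
have <- := @spoke_csize i v (ltnW i5).
have <- := @spoke_csize j.+1 (e i v) j5.
by rewrite csize_step -[e j.+1 _]/(rot (e i v) (e j (e i v))) -E.
Qed.

Lemma spoke00 v : e 0 (e 0 v) = v.
Proof.
by have [j [+ {2}-> /=]] := @spoke_rev 0 v isT; case: j => [|[|[|[|[]]]]].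
Qed.

Lemma spoke41 v : e 4 (e 1 v) = v.
Proof.
by have [j [+ {2}-> /=]] := @spoke_rev 1 v isT; case: j => [|[|[|[|[]]]]].
Qed.

Lemma spoke14 v : e 1 (e 4 v) = v.
Proof.
by have [j [+ {2}-> /=]] := @spoke_rev 4 v isT; case: j => [|[|[|[|[]]]]].
Qed.

Lemma triangle_step i v : 1 < i < 5 ->
  let C := rot (e i v) v in rot C (e i v) = v /\ rot v C = e i v.
Proof.
move=> /andP[i1 i5]; have := csize_iter (spoke_nbhd i v).
rewrite spoke_csize 1?ltnW //.
by case: i i1 i5 => [|[|[|[|[|//]]]]] // _ _ /= [E1]; rewrite E1 => E2.
Qed.

(** Around [e 2 v] the neighbour after [v] is the third vertex [e 1 v] of the triangle. Both edges
    lie between triangles, so both are spokes 2 or 3 of [e 2 v]; being consecutive, they are 2 and 3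
    in this order. *)
Lemma triangle_spokes v :
  [/\ rot (e 2 v) v = e 1 v, e 3 (e 1 v) = e 2 v & e 2 (e 2 v) = v].
Proof.
have [] := @triangle_step 2 v isT => E1 E2.
have C1 : rot (e 2 v) v = e 1 v by apply: (@perm_inj _ (rot v)); rewrite E2.
rewrite C1 in E1.
have B3 : e 3 (e 1 v) = e 2 v.
  by apply: (@perm_inj _ (rot (e 1 v))); rewrite E1 -[RHS]spoke41.
have v2 : e 2 (e 2 v) = v.
  have [j [j5 Ej /= c1 c2]] := @spoke_rev 2 v isT.
  have [j' [j5' Ej' /= c1' c2']] := @spoke_rev 3 (e 1 v) isT.
  rewrite B3 in Ej'.
  have jj : e j' (e 2 v) = e j.+1 (e 2 v) by rewrite -Ej' -C1 /= -Ej.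
  have j34 : j.+1 < 5 by case: j c1 c2 {Ej jj} j5 => [|[|[|[|[]]]]].
  have := spoke_uniq j5' j34 jj.
  case: j j5 c1 c2 Ej {jj j34} => [|[|[|[|[]]]]] // _ _ _ Ej jE.
  by rewrite jE in c2'.
by [].
Qed.

Lemma spoke22 v : e 2 (e 2 v) = v. Proof. by case: (triangle_spokes v). Qed.

Lemma spoke33 v : e 3 (e 3 v) = v.
Proof.
have [j [j5 Ej /= c1 c2]] := @spoke_rev 3 v isT.
case: j j5 c1 c2 Ej => [|[|[|[|[]]]]] // _ _ _ Ej.
(* If [v] were spoke 2 of [e 3 v], the symmetry of spoke 2 would identify two spokes of [v]. *)
have : e 2 v = e 3 v by rewrite {1}Ej spoke22.
by move/spoke_uniq => /(_ isT isT).
Qed.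

Lemma spoke43 v : e 4 (e 3 v) = e 2 v.
Proof.
have [] := @triangle_step 3 v isT => E1 E2.
apply: (@perm_inj _ (rot v)); rewrite -[RHS]E2; congr (rot v (rot _ _)).
exact: spoke33.
Qed.

Lemma spoke12 v : e 1 (e 2 v) = e 3 v.
Proof. by rewrite -spoke43 spoke14. Qed.

Lemma quad_step v : [/\ rot (e 1 v) v = e 0 (e 1 v),
  rot (e 0 (e 1 v)) (e 1 v) = e 1 (e 0 (e 1 v)) & e 1 (e 0 (e 1 v)) = e 0 v].
Proof.
have C0 : rot (e 1 v) v = e 0 (e 1 v) by rewrite -spoke5 -{2}(spoke41 v).
have D1 : rot (e 0 (e 1 v)) (e 1 v) = e 1 (e 0 (e 1 v)).
  by rewrite -{2}(spoke00 (e 1 v)).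
split=> //; have := csize_iter (spoke_nbhd 1 v); rewrite spoke_csize // => -[].
rewrite -/(e 0 v) -/(e 1 v) C0 D1 => E1; rewrite E1 => E2.
by apply: (@perm_inj _ (rot v)); rewrite E2.
Qed.

Lemma verts_quad v : verts_of (face_of M (v, e 1 v)) =
  [set v; e 1 v; e 0 v; e 0 (e 1 v)].
Proof.
have [C D E] := quad_step v; apply/setP=> z.
rewrite verts_face ?spoke_nbhd // spoke_csize // !inE /=.
rewrite -/(e 0 v) -/(e 1 v) C D E.
by case: (z == v); case: (z == e 1 v); case: (z == e 0 v); case: (z == _).
Qed.

Lemma verts_triangle v : verts_of (face_of M (v, e 2 v)) =
  [set v; e 1 v; e 2 v].
Proof.
have [C _ _] := triangle_spokes v; apply/setP=> z.
rewrite verts_face ?spoke_nbhd // spoke_csize // !inE /=.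
rewrite -/(e 0 v) -/(e 1 v) -/(e 2 v) C.
by case: (z == v); case: (z == e 1 v); case: (z == e 2 v).
Qed.

(** From any corner, at most two steps back along the boundary lead to a corner between spokes 0 and
    1, or 1 and 2, of a vertex. *)
Lemma face_vertex_setsE : face_vertex_sets M =
  [set [set v; e 1 v; e 0 v; e 0 (e 1 v)] | v : V] :|:
  [set [set v; e 1 v; e 2 v] | v : V].
Proof.
have prev i u : face_of M (e i u, u) = face_of M (u, e i.+1 u).
  by rewrite -(face_of_step (e i u, u)).
apply/setP=> A; apply/imsetP/setUP => [[F /imsetP[[u w]]]|].
  rewrite inE /= => /spokeP[i i5 ->] -> ->.
  case: i i5 => [|[|[|[|[|//]]]]] _.
  - left; apply/imsetP; exists (e 4 u) => //.
    by rewrite -spoke5 -prev -{2}(spoke14 u) verts_quad.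
  - by left; apply/imsetP; exists u; rewrite ?verts_quad.
  - by right; apply/imsetP; exists u; rewrite ?verts_triangle.
  - right; apply/imsetP; exists (e 2 u) => //.
    by rewrite -prev -{2}(spoke22 u) verts_triangle.
  - right; apply/imsetP; exists (e 2 (e 3 u)) => //.
    by rewrite -prev -{2}(spoke33 u) -prev -{2}(spoke22 (e 3 u)) verts_triangle.
case=> /imsetP[v _ ->].
  exists (face_of M (v, e 1 v)); first exact/face_of_faces/spoke_nbhd.
  by rewrite verts_quad.
exists (face_of M (v, e 2 v)); first exact/face_of_faces/spoke_nbhd.
by rewrite verts_triangle.
Qed.

Lemma spoke23_not_in_quad u w i : 1 < i < 4 ->
  w \in [set u; e 1 u; e 0 u; e 0 (e 1 u)] ->
  e i w \in [set u; e 1 u; e 0 u; e 0 (e 1 u)] -> False.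
Proof.
move=> i24; rewrite -verts_quad; apply: quad_triangle_edge.
- exact: spoke_nbhd.
- exact/face_of_faces/spoke_nbhd.
- by rewrite -csize_card ?spoke_nbhd // spoke_csize.
- by rewrite spoke_csize; case: i i24 => [|[|[|[|[]]]]].
- rewrite csize_step -[rot _ _]/(e i.+1 w) spoke_csize;
  by case: i i24 => [|[|[|[|[]]]]].
Qed.
End Frame.
End LocalStructure.

(** [a] and [x] are spokes 1 and 0. Spoke 2 is an involution, a half turn; composing it with [x]
    gives the translation [b]. *)
Lemma strip_action_exists (V : finType) (M : embedding V) :
  torus_map M -> semi_equivelar [:: 3; 3; 3; 4; 4] M ->
  exists a b x, strip_action (face_vertex_sets M) a b x.
Proof.
move=> tM sM; have [e0 fr] := fin_all_exists (frame_exists tM sM).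
pose e := spoke M e0.
have e00 v : e 0 (e 0 v) = v := spoke00 tM fr v.
have e41 v : e 4 (e 1 v) = v := spoke41 tM fr v.
have e14 v : e 1 (e 4 v) = v := spoke14 tM fr v.
have e22 v : e 2 (e 2 v) = v := spoke22 tM fr v.
have e12 v : e 1 (e 2 v) = e 3 v := spoke12 tM fr v.
have e31 v : e 3 (e 1 v) = e 2 v by case: (triangle_spokes tM fr v).
have quadE v : e 1 (e 0 (e 1 v)) = e 0 v by case: (quad_step tM fr v).
have inb i v : e i v \in nbhd M v := spoke_nbhd tM fr i v.
have euniq v i j : i < 5 -> j < 5 -> e i v = e j v -> i = j.
  exact: (spoke_uniq fr).
have eirr i v : e i v <> v.
  by move=> E; have := nbhd_irr tM v; rewrite -{1}E inb.
have bK : cancel (fun v => e 2 (e 0 v)) (fun v => e 0 (e 2 v)).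
  by move=> v; rewrite e22 e00.
pose a := perm (can_inj e41); pose x := perm (can_inj e00).
pose b := perm (can_inj bK).
have aE v : a v = e 1 v by rewrite permE.
have xE v : x v = e 0 v by rewrite permE.
have bE v : b v = e 2 (e 0 v) by rewrite permE.
have bx v : b (x v) = e 2 v by rewrite bE xE e00.
exists a, b, x; split.
- rewrite (face_vertex_setsE tM fr).
  congr (_ :|: _); apply: eq_imset => v;
  by rewrite /quad /triangle ?bx ?aE ?xE ?aE.
- by move=> v; rewrite !xE e00.
- by move=> v; rewrite !aE !bE e12 -(quadE v) e31.
- by move=> v; rewrite !aE !xE quadE e00.
- by move=> v; rewrite !bE !xE e00 e22 e00.
- move=> A clA v w Av.
  have clE u i : A u -> i < 5 -> A (e i u).
    move=> Au; have [aA bA xA] := clA _ Au.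
    have [_ b2A _] := clA _ xA; rewrite bx in b2A.
    have [a3A _ _] := clA _ b2A; rewrite aE e12 in a3A.
    (* Spoke 4, the inverse of [a], is reached as [a] conjugated by [x]. *)
    have [a4A _ _] := clA _ xA; have [_ _ x4A] := clA _ a4A.
    rewrite xE aE xE -(e14 u) quadE e00 in x4A.
    by case: i => [|[|[|[|[|//]]]]] _ //; rewrite -?aE -?xE.
  have cl : closed (adj M) A.
    apply: (intro_closed (sym_connect_sym (fun p q => nbhd_sym tM p q))).
    by move=> p q; rewrite /adj /= => /(spokeP fr)[i i5 ->] Ap; apply: clE.
  by have := closed_connect cl (map_connect tM v w); rewrite !unfold_in => <-.
- move=> v; rewrite aE xE bE aE; split.
  + exact: eirr.
  + by move/(euniq v 0 1 isT isT).
  + by move/esym/eirr.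
  + by rewrite e12 => /esym/eirr.
- move=> v; rewrite !bE !aE; split.
  + by rewrite -{2}(e41 v) => E; have := euniq (e 1 v) 1 4 isT isT E.
  + by rewrite -{2}(e00 v) => E; have := euniq (e 0 v) 2 0 isT isT E.
  + by rewrite e12 -{2}(e00 v) => E; have := euniq (e 0 v) 3 0 isT isT E.
  + move=> E; apply: (@spoke23_not_in_quad _ _ tM e0 fr v (e 0 v) 2) => //.
      by rewrite !inE eqxx !orbT.
    by rewrite -/e E !inE eqxx !orbT.
  (* Spoke 3 of [e 0 v] would be [e 4 v], which shares the quadrangle starting at [e 4 v] with
     [e 0 v]. *)
  + move=> E; apply: (@spoke23_not_in_quad _ _ tM e0 fr (e 4 v) (e 0 v) 3) => //.
      by rewrite -/e e14 !inE eqxx !orbT.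
    by rewrite -/e -e12 -(e41 (e 1 _)) E !inE eqxx.
Qed.

(** * The lattice of a map *)

Section Coordinates.
Variables (V : finType) (F : {set {set V}}) (a b x : {perm V}).
Hypothesis act : strip_action F a b x.
Local Open Scope group_scope.

Lemma strip_commute : commute a b.
Proof. by apply/permP=> v; rewrite !permM (strip_ab act). Qed.

Lemma strip_conj_a : a ^ x = a^-1.
Proof.
apply: (mulIg a); rewrite mulVg /conjg; apply/permP=> v.
rewrite !permM perm1 -[v in RHS](permKV x); apply: (@perm_inj _ x).
by rewrite (strip_xaxa act) (strip_xx act).
Qed.

Lemma strip_conj_b : b ^ x = b^-1.
Proof.
apply: (mulIg b); rewrite mulVg /conjg; apply/permP=> v.
rewrite !permM perm1 -[v in RHS](permKV x); apply: (@perm_inj _ x).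
by rewrite (strip_xbxb act) (strip_xx act).
Qed.

(* The defining property of the elements of [p2] that are translations. *)
Definition translation (h : {perm V}) :=
  [/\ commute a h, commute b h & h ^ x = h^-1].

Lemma translationM h h' : commute h h' ->
  translation h -> translation h' -> translation (h * h').
Proof.
move=> hh' [ah bh xh] [ah' bh' xh']; split; try exact: commuteM.
by rewrite conjMg xh xh' -invMg hh'.
Qed.

Lemma translationV h : translation h -> translation h^-1.
Proof. by case=> ah bh xh; split; rewrite ?conjVg ?xh //; apply: commuteV. Qed.

Lemma translationX h i : translation h -> translation (h ^+ i).
Proof.
by case=> ah bh xh; split; rewrite ?conjXg ?xh -?expVgn //; apply: commuteX.
Qed.

Lemma translation_a : translation a.
Proof. by split; rewrite ?strip_conj_a //; apply/commute_sym/strip_commute. Qed.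

Lemma translation_b : translation b.
Proof. by split; rewrite ?strip_conj_b //; apply/strip_commute. Qed.

Lemma translation_half_turn h v : translation h -> x (h v) = h^-1 (x v).
Proof. by case=> _ _ <-; rewrite -!permM /conjg !mulgA mulgV mul1g. Qed.

(** The vertices fixed by [h] are stable under [a], [b] and [x], so transitivity spreads one fixed
    vertex to all. *)
Lemma translation_free h v : translation h -> h v = v -> h = 1.
Proof.
move=> trh hv; have [ah bh xh] := trh.
apply/permP=> w; rewrite perm1; apply/eqP.
apply: (@strip_trans _ _ _ _ _ act (fun u => h u == u) _ v); last exact/eqP.
move=> u /eqP hu; split.
- by rewrite -permM ah permM hu.
- by rewrite -permM bh permM hu.
- by apply/eqP/(canLR (permKV h)); rewrite -translation_half_turn // hu.
Qed.

Definition shift i j := a ^+ i * b ^+ j.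

Lemma shiftM i j i' j' : shift i j * shift i' j' = shift (i + i') (j + j').
Proof.
rewrite /shift !expgD -!mulgA; congr (_ * _); rewrite !mulgA; congr (_ * _).
by apply/commuteX2/commute_sym/strip_commute.
Qed.

Lemma translation_shift i j : translation (shift i j).
Proof.
by apply: translationM; [apply/commuteX2/strip_commute | |]; apply: translationX;
  [apply: translation_a | apply: translation_b].
Qed.

Lemma shift_inj i j i' j' v :
  shift i j v = shift i' j' v -> shift i j = shift i' j'.
Proof.
set h := shift i j; set h' := shift i' j' => E.
have chh' : commute h h'^-1.
  by apply: commuteV; rewrite /commute !shiftM addnC (addnC j).
have tr : translation (h * h'^-1).
  by apply: translationM => //; [|apply: translationV]; apply: translation_shift.
have /(translation_free tr) : (h * h'^-1) (h' v) = h' v.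
  by rewrite -permM chh' mulgA mulgV mul1g E.
by move/(canRL (mulgKV _)); rewrite mul1g.
Qed.

(* Translating [v] halfway reduces [i] and [j] modulo 2, that is, to one of the
   four conjugacy classes of half turns. *)
Lemma half_turn_not_shift i j v : x v <> shift i j v.
Proof.
move=> E; pose h := shift i./2 j./2; pose w := h v.
have : x w = shift (odd i) (odd j) w.
  rewrite /w translation_half_turn ?E; last exact: translation_shift.
  apply: (@perm_inj _ h); rewrite permKV -!permM !shiftM.
  by congr (shift _ _ v); lia.
have [] := strip_half_turns act w.
rewrite /shift; case: (odd i); case: (odd j);
  by rewrite ?expg0 ?expg1 ?mul1g ?mulg1 ?perm1 // permM (strip_ab act).
Qed.

Lemma half_turn_shift i j i' j' v : x (shift i j v) <> shift i' j' v.
Proof.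
rewrite translation_half_turn; last exact: translation_shift.
by move/esym/(canLR (permKV _)); rewrite -permM shiftM => /esym/half_turn_not_shift.
Qed.

(** Vertices of this form are stable under [a], [b] and [x]: a translation passes [x] on being
    inverted, and inverses are natural powers because the orders are finite. *)
Lemma shift_trans v0 v : exists i j (c : bool), v = (x ^+ c) (shift i j v0).
Proof.
pose H := <[a]> * <[b]>.
have HM h : h \in H -> exists i j, h = shift i j.
  by case/mulsgP=> _ _ /cycleP[i ->] /cycleP[j ->] ->; exists i, j.
have shH i j : shift i j \in H by rewrite mem_mulg ?mem_cycle.
pose A u := [exists c : bool, exists h in H, u == (x ^+ c) (h v0)].
have Av0 : A v0.
  apply/existsP; exists false; apply/exists_inP; exists 1.
    by rewrite -[1]mulg1 mem_mulg ?group1.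
  by rewrite expg0 !perm1.
have AI i j (c : bool) : A ((x ^+ c) (shift i j v0)).
  by apply/existsP; exists c; apply/exists_inP; exists (shift i j).
have xV : x^-1 = x.
  apply/permP=> u; apply: (@perm_inj _ x); by rewrite permKV (strip_xx act).
have : A v.
  apply: (strip_trans act) Av0 => u.
  case/existsP=> c /exists_inP[h /HM[i [j ->]] /eqP->].
  have half g : translation g -> g (x (shift i j v0)) = x (g^-1 (shift i j v0)).
    by move=> trg; rewrite (translation_half_turn _ (translationV trg)) invgK.
  have ai : a^-1 = shift #[a].-1 0 by rewrite /shift expg0 mulg1 invg_expg.
  have bi : b^-1 = shift 0 #[b].-1 by rewrite /shift expg0 mul1g invg_expg.
  case: c; rewrite ?expg1 ?expg0 ?perm1; split.
  - rewrite (half _ translation_a) ai -(permM (shift i j)) shiftM.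
    exact: (AI _ _ true).
  - rewrite (half _ translation_b) bi -(permM (shift i j)) shiftM.
    exact: (AI _ _ true).
  - by rewrite (strip_xx act); have := AI i j false; rewrite expg0 perm1.
  - have := AI (i + 1) (j + 0) false.
    by rewrite expg0 perm1 -shiftM permM /shift expg0 expg1 mulg1.
  - have := AI (i + 0) (j + 1) false.
    by rewrite expg0 perm1 -shiftM permM /shift expg0 expg1 mul1g.
  - exact: (AI i j true).
by case/existsP=> c /exists_inP[h /HM[i [j ->]] /eqP->]; exists i, j, c.
Qed.

Lemma shift_norm r s k i j : 0 < r -> 0 < s -> a ^+ r = 1 -> b ^+ s = a ^+ k ->
  exists i' j', [/\ i' < r, j' < s & shift i j = shift i' j'].
Proof.
move=> r0 s0 ar bs; exists ((i + k * (j %/ s)) %% r), (j %% s).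
rewrite !ltn_pmod //; split=> //; rewrite /shift expg_mod // {1}(divn_eq j s).
by rewrite expgD mulnC expgM bs -expgM mulgA -expgD mulnC.
Qed.
End Coordinates.

(** The normal forms with [i < r] and [j < s] reach every vertex; the cardinality says that they are
    distinct. *)
Definition strip_lattice (V : finType) (F : {set {set V}}) r s k a b x :=
  [/\ strip_action F a b x, (a ^+ r = 1)%g, (b ^+ s = a ^+ k)%g
    & #|V| = 2 * r * s].

(** [r] is the order of [a], and [s] the least positive exponent for which [b ^+ s] is a power of
    [a]. If [s = 1], then [b = a ^+ k], and the clauses of [strip_shifts] exclude 0, 1, [r - 1] and
    [r - 2] for [k]. *)
Lemma strip_lattice_exists (V : finType) (F : {set {set V}}) a b x (v0 : V) :
  strip_action F a b x -> exists r s k,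
  [/\ 2 < r, 0 < s, k < r, s = 1 -> 1 < k < r - 2
    & strip_lattice F r s k a b x].
Proof.
move=> act; pose r := #[a]%g.
have sh_exists : exists s, (0 < s) && (b ^+ s \in <[a]>)%g.
  by exists #[b]%g; rewrite order_gt0 expg_order group1.
have [s /andP[s0 bs] smin] := ex_minnP sh_exists.
have [k kr bk] : exists2 k, k < r & (b ^+ s = a ^+ k)%g.
  by have /cyclePmin[k kr E] := bs; exists k.
have [aav bv abv bav aabv] := strip_shifts act v0.
have r2 : 2 < r.
  have := order_gt0 a; rewrite -/r; case Er: r => [|[|[|//]]] // _.
    by case: aav; rewrite -[a]expg1 -Er expg_order !perm1.
  by case: aav; rewrite -permM -[(a * a)%g]/(a ^+ 2)%g -Er expg_order perm1.
exists r, s, k; split=> //.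
  move=> s1; rewrite s1 expg1 in bk.
  have ak m : k + m = r -> (a ^+ m)%g (b v0) = v0.
    by move=> kmr; rewrite bk -permM -expgD kmr expg_order perm1.
  have k_neq0 : k <> 0 by move=> k0; case: bv; rewrite bk k0 perm1.
  have k_neq1 : k <> 1 by move=> k1; case: bav; rewrite bk k1.
  have k_neqr1 : k + 1 <> r by move/ak; rewrite expg1.
  have k_neqr2 : k + 2 <> r by move/ak; rewrite expgS expg1 permM.
  by lia.
split=> //; first exact: expg_order.
(* Normal forms are counted by [f]: it is injective because no half turn agrees with a translation
   at a vertex and [s] is minimal, and onto by [shift_norm]. *)
pose f (p : bool * 'I_r * 'I_s) := (x ^+ p.1.1)%g (shift a b p.1.2 p.2 v0).
have lej i j i' j' : j' < s -> shift a b i j = shift a b i' j' -> j' <= j.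
  move=> js E; case: leqP => // jj'.
  have := smin (j' - j); rewrite subn_gt0 jj'.
  suff -> : (b ^+ (j' - j))%g \in <[a]>%g by move/(_ isT); lia.
  have -> : (b ^+ (j' - j) = (a ^+ i') ^-1 * a ^+ i)%g.
    apply: (mulgI (a ^+ i')%g); apply: (mulIg (b ^+ j)%g).
    by rewrite mulKVg -mulgA -expgD subnK 1?ltnW.
  by rewrite groupM ?groupV ?mem_cycle.
have f_inj : injective f.
  move=> [[c i] j] [[c' i'] j'] /=; rewrite /f /= => E.
  have cc' : c = c'.
    case: c c' E => -[] //; rewrite ?expg1 ?expg0 ?perm1.
      by move/(half_turn_shift act).
    by move/esym/(half_turn_shift act).
  rewrite cc' in E *; move/perm_inj/(shift_inj act): E => E.
  have jj' : j = j' :> nat.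
    by apply/eqP; rewrite eqn_leq (lej _ _ _ _ _ E) // (lej _ _ _ _ _ (esym E)).
  have : (a ^+ i = a ^+ i')%g by move: E; rewrite /shift jj' => /mulIg.
  move/eqP; rewrite eq_expg_mod_order !modn_small // => /eqP ii'.
  by congr (_, _, _); apply: val_inj.
rewrite -card_bool -[r]card_ord -[s]card_ord -!card_prod -(card_codom f_inj).
apply: eq_card => v; rewrite !inE; apply/esym.
have [i [j [c ->]]] := shift_trans act v0 v.
have r0 : 0 < r by exact: ltn_trans r2.
have [i' [j' [ir js ->]]] := shift_norm i j r0 s0 (expg_order a) bk.
exact: (codom_f f (c, Ordinal ir, Ordinal js)).
Qed.

(* The mirror image of the frames: [b] and [a * b] trade places. *)
Lemma strip_action_mirror (V : finType) (F : {set {set V}}) a b x :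
  strip_action F a b x -> strip_action F a^-1%g (a * b)%g x.
Proof.
move=> act; have cab := strip_ab act; have xx := strip_xx act.
have axa v : a (x (a v)) = x v.
  by apply: (@perm_inj _ x); rewrite (strip_xaxa act) xx.
have xaV v : x (a^-1%g v) = a (x v) by rewrite -axa permKV.
split=> //.
(* The mirrored quadrangle and triangle at [v] are the original ones at [a^-1 v]. *)
- rewrite (strip_faces act); congr (_ :|: _).
    apply/setP=> A; apply/imsetP/imsetP=> -[v _ ->].
      exists (a v) => //; apply/setP=> z; rewrite /quad !inE permK.
      case: (z == v); case: (z == a v); case: (z == x v);
      by case: (z == x (a v)).
    exists (a^-1%g v) => //; apply/setP=> z; rewrite /quad !inE permKV.
    case: (z == v); case: (z == a^-1%g v); case: (z == x v);
    by case: (z == x _).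
  apply/setP=> A; apply/imsetP/imsetP=> -[v _ ->].
    exists (a v) => //; apply/setP=> z; rewrite /triangle !inE permK permM axa.
    by case: (z == v); case: (z == a v).
  exists (a^-1%g v) => //; apply/setP=> z; rewrite /triangle !inE permKV permM xaV.
  by case: (z == v); case: (z == a^-1%g v).
- by move=> v; rewrite !permM permKV -cab permK.
- by move=> v; rewrite !xaV axa xx.
- by move=> v; rewrite !permM -[b (a v)]cab axa (strip_xbxb act).
- move=> A clA; apply: (strip_trans act) => v Av.
  have clx u : A u -> A (x u) by case/clA.
  have cla u : A u -> A (a u).
    by move=> /clx/clA[/clx + _ _]; rewrite xaV xx.
  split; [exact: cla | | exact: clx].
  by have [_ /clA[+ _ _] _] := clA _ Av; rewrite permM -cab permK.
- move=> v; have [h1 h2 h3 h4] := strip_half_turns act v; rewrite !permM -cab.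
  split=> //.
    have [_ + _ _] := strip_half_turns act (x v); rewrite xx => + E; apply.
    by rewrite E permKV.
  by rewrite permK.
- move=> v; have [aav bv abv bav aabv] := strip_shifts act v; rewrite !permM -!cab.
  split=> //.
  + by move/(canRL (permKV a))/(canRL (permKV a))/esym.
  + by rewrite permK.
  + by move=> E; apply: aabv; rewrite E permKV.
  + by rewrite permK => /(canRL (permKV a)).
Qed.

(** As [a] and [b] commute, [(a * b) ^+ s = a ^+ (s + k)]; modulo [r] this exponent is that of the
    [k']-th power of [a^-1]. *)
Lemma strip_lattice_mirror (V : finType) (F : {set {set V}}) r s k k' a b x :
  r %| k + k' + s -> strip_lattice F r s k a b x ->
  strip_lattice F r s k' a^-1 (a * b) x.
Proof.
move=> /dvdnP[m E] [act ar bs cardV]; split=> //.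
- exact: strip_action_mirror.
- by rewrite expgVn ar invg1.
rewrite expgMn; last exact: strip_commute act.
rewrite bs -expgD expgVn; apply: (mulIg (a ^+ k')%g).
by rewrite mulVg -expgD (_ : _ + _ = r * m) ?expgM ?ar ?expg1n //; lia.
Qed.

(** * Checking a map given by lists *)

Section CyclePerm.
Variable V : finType.

(** [undup] makes this a permutation for every list. *)
Definition cycle_perm (c : seq V) : {perm V} :=
  perm (can_inj (prev_next (undup_uniq c))).

Lemma cycle_permE c : uniq c -> cycle_perm c =1 next c.
Proof. by move=> uc v; rewrite permE undup_id. Qed.

Definition rotation_map (nb : V -> seq V) : embedding V :=
  Embedding [ffun v => [set w in nb v]] [ffun v => cycle_perm (nb v)].
End CyclePerm.

Section RotationMap.
Variables (V : finType) (vs : seq V) (nb : V -> seq V) (fs : seq (seq (V * V))).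
(* Connectedness is checked through neighbours of smaller rank. *)
Variable rk : V -> nat.

Definition trace_step (d : V * V) := (d.2, next (nb d.2) d.1).
Definition corners (c : seq (V * V)) := [seq d.1 | d <- c].
Definition face_at d := nth [::] fs (find (fun c => d \in c) fs).
(** Every edge is represented by its dart of increasing rank, so edges are counted once. *)
Definition edge_list :=
  [seq d <- [seq (v, w) | v <- vs, w <- nb v] | rk d.1 < rk d.2].

Definition graph_check :=
  all (fun v => [&& uniq (nb v), v \notin nb v, all (fun w => v \in nb w) (nb v)
    & (rk v == 0) || has (fun w => rk w < rk v) (nb v)]) vs.

Definition faces_check :=
  [&& all (fun c => [&& 2 < size c, uniq (corners c), fcycle trace_step c
             & all (fun d => d.2 \in nb d.1) c]) fs,
      all (fun v => all (fun w => has (fun c => (v, w) \in c) fs) (nb v)) vs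
    & all (fun v =>
        [seq size (face_at (v, w)) | w <- nb v] == [:: 3; 3; 3; 4; 4]) vs].

(** Two faces run through a common edge in opposite directions, hence the reversed dart. *)
Definition polyhedral_check :=
  all (fun c : seq (V * V) => all (fun c' : seq (V * V) => (c == c') ||
    ~~ has (mem c') c &&
    let m := [seq z <- corners c | z \in corners c'] in
    (size m <= 1) ||
    has (fun d =>
      ((d.2, d.1) \in c') && all (fun z => z \in [:: d.1; d.2]) m) c) fs) fs.

Definition euler_check :=
  [&& uniq fs, uniq edge_list & size vs + size fs == size edge_list].

Hypotheses (vs_uniq : uniq vs) (vs_all : forall v, v \in vs).
Hypothesis rk_inj : injective rk.
Hypotheses (graphP : graph_check) (facesP : faces_check).
Hypotheses (polyP : polyhedral_check) (eulerP : euler_check).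

Local Notation M := (rotation_map nb).

Let nbE v w : (w \in nbhd M v) = (w \in nb v).
Proof. by rewrite ffunE inE. Qed.

Let nb_uniq v : uniq (nb v).
Proof. by case/and4P: (allP graphP v (vs_all v)). Qed.

Let nb_irr v : v \notin nb v.
Proof. by case/and4P: (allP graphP v (vs_all v)). Qed.

Let nb_sym v w : (w \in nb v) = (v \in nb w).
Proof.
by apply/idP/idP => H; [case/and4P: (allP graphP v (vs_all v))
  | case/and4P: (allP graphP w (vs_all w))] => _ _ /allP/(_ _ H).
Qed.

Let rotE v : vrot M v =1 next (nb v).
Proof. by move=> w; rewrite ffunE cycle_permE. Qed.

Let stepE : face_step M =1 trace_step.
Proof. by move=> d; rewrite /face_step rotE. Qed.

Let dartsE d : (d \in darts M) = (d.2 \in nb d.1).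
Proof. by rewrite inE /adj /= nbE. Qed.

Let face_of_list c d : c \in fs -> d \in c -> face_of M d = [set z in c].
Proof.
move=> cfs dc; case/and3P: facesP => /allP/(_ _ cfs)/and4P[_ uc cyc _] _ _.
apply/setP=> z; rewrite !inE (eq_fconnect stepE).
by apply: (fconnect_cycle cyc).
Qed.

Let dart_face d : d \in darts M -> exists2 c, c \in fs & d \in c.
Proof.
rewrite dartsE; case: d => v w /= vw.
case/and3P: facesP => _ /allP/(_ _ (vs_all v)) + _.
by move/allP/(_ _ vw)/hasP.
Qed.

Let facesE : faces M =i [seq [set z in c] | c : seq (V * V) <- fs].
Proof.
move=> A; apply/imsetP/mapP=> [[d dM ->]|[c cfs ->]].
  by have [c cfs dc] := dart_face dM; exists c => //; apply: face_of_list.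
case/and3P: facesP => /allP/(_ _ cfs)/and4P[sc _ _ /allP dc] _ _.
case: c => [//|d c] in cfs sc dc *; have dd : d \in d :: c by rewrite inE eqxx.
by exists d; [rewrite dartsE dc | rewrite (face_of_list cfs)].
Qed.

Let vertsE (c : seq (V * V)) : verts_of [set z in c] = [set v in corners c].
Proof.
apply/setP=> v; rewrite inE; apply/imsetP/mapP=> -[d dc ->]; exists d => //.
  by rewrite inE in dc.
by rewrite inE.
Qed.

Lemma rotation_map_face_vertex_sets :
  face_vertex_sets M =i [seq [set v in corners c] | c <- fs].
Proof.
move=> A; apply/imsetP/mapP=> [[F]|[c cfs ->]].
  by rewrite facesE => /mapP[c cfs ->] ->; exists c; rewrite ?vertsE.
by exists [set z in c]; rewrite ?vertsE // facesE map_f.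
Qed.

Let card_verts c : c \in fs -> #|verts_of [set z in c]| = size c.
Proof.
move=> cfs; rewrite vertsE cardsE -(size_map fst); apply/card_uniqP.
by case/and3P: facesP => /allP/(_ _ cfs)/and4P[].
Qed.

Let card_face c : c \in fs -> #|[set z in c]| = size c.
Proof.
move=> cfs; rewrite cardsE; apply/card_uniqP/(@map_uniq _ _ fst).
by case/and3P: facesP => /allP/(_ _ cfs)/and4P[].
Qed.

Let simpleM : simple_graph M.
Proof.
apply/andP; split; last by apply/forallP=> v; rewrite /adj /= nbE.
by apply/forallP=> v; apply/forallP=> w; rewrite /adj /= !nbE nb_sym.
Qed.

Let orbitM v w : w \in nb v -> orbit (vrot M v) w = rot (index w (nb v)) (nb v).
Proof.
move=> wv; rewrite (@orbitE _ _ (nb v)) //.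
by rewrite (eq_fcycle (rotE v)); apply: cycle_next.
Qed.

Let rotationM : is_rotation M.
Proof.
apply/forallP=> v; apply/andP; split.
  apply/subsetP=> w; rewrite inE rotE nbE; apply: contraR => wv.
  by rewrite next_nth (negPf wv).
apply/forall_inP=> w; rewrite nbE => wv; apply/eqP/setP=> z; rewrite nbE.
rewrite -(mem_rot (index w (nb v))) -orbitM // -fconnect_orbit.
apply/porbitP/idP => [[i ->]|/iter_findex <-].
  by rewrite permX; apply: fconnect_iter.
by exists (findex (vrot M v) w z); rewrite permX.
Qed.

Let connectedM (v0 : V) : connected_graph M.
Proof.
have symM : connect_sym (adj M).
  by apply: sym_connect_sym => p q; rewrite /adj /= !nbE nb_sym.
have [u0 u00] : exists u0, forall v, connect (adj M) v u0.
  (* A vertex of least rank must have rank 0, and every vertex descends to it through neighbours of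
     smaller rank. *)
  have [u0 _ umin] := @arg_minnP _ v0 predT rk isT.
  have rku0 : rk u0 = 0.
    case/and4P: (allP graphP u0 (vs_all u0)) => _ _ _ /orP[/eqP//|/hasP[w _]].
    by rewrite ltnNge umin.
  exists u0 => v; elim: (rk v).+1 {-2}v (ltnSn (rk v)) => // m IH {}v.
  rewrite ltnS => vm.
  case/and4P: (allP graphP v (vs_all v)) => _ _ _ /orP[/eqP rv|/hasP[w vw rw]].
    by rewrite (rk_inj (etrans rv (esym rku0))).
  apply: connect_trans (IH w (leq_trans rw vm)); apply: connect1.
  by rewrite /adj /= nbE.
rewrite /connected_graph -(eq_n_comp_r (a := connect (adj M) u0)).
  by rewrite n_comp_connect.
by move=> v; rewrite !inE symM u00.
Qed.

Let closedM : closed_cell_faces M.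
Proof.
apply/forall_inP=> F; rewrite facesE => /mapP[c cfs ->].
rewrite card_verts // card_face // eqxx andbT.
by case/and3P: facesP => /allP/(_ _ cfs)/and4P[].
Qed.

Let polyhedralM : polyhedral M.
Proof.
apply/forall_inP=> F; rewrite facesE => /mapP[c cfs ->].
apply/forall_inP=> G; rewrite facesE => /mapP[c' cfs' ->]; apply/implyP=> neq.
have := allP (allP polyP c cfs) c' cfs'; case: eqP => [E|_ /=].
  by rewrite E eqxx in neq.
case/andP=> _; rewrite !vertsE.
set m := [seq z <- _ | _].
have -> : [set v in corners c] :&: [set v in corners c'] = [set v in m].
  by apply/setP=> v; rewrite !inE mem_filter andbC.
case/orP=> [m1|/hasP[d dc /andP[dc' /allP dm]]].
  by rewrite cardsE (leq_trans (card_size _) m1).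
apply/orP; right.
have edge_of (e : V * V) (D : seq (V * V)) : e \in D ->
    [set e.1; e.2] \in edges_of [set z in D].
  by move=> eD; apply/imsetP; exists e; rewrite ?inE.
have next_corner D e : D \in fs -> e \in D ->
    e.1 \in corners D /\ e.2 \in corners D.
  move=> Dfs eD; split; first exact: map_f.
  case/and3P: facesP => /allP/(_ _ Dfs)/and4P[_ _ cyc _] _ _.
  have E := next_cycle cyc eD.
  have -> : e.2 = (next D e).1 by rewrite -(eqP E).
  by apply: map_f; rewrite mem_next.
have -> : [set v in m] = [set d.1; d.2].
  apply/setP=> z; rewrite !inE; apply/idP/idP; first by move/dm; rewrite !inE.
  have [d1 d2] := next_corner _ _ cfs dc.
  have [d1' d2'] := next_corner _ _ cfs' dc'.
  by rewrite mem_filter; case/orP=> /eqP->; apply/andP.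
by rewrite inE edge_of //= setUC (edge_of (d.2, d.1)).
Qed.

Let eulerM : euler_zero M.
Proof.
rewrite /euler_zero; case/and3P: eulerP => ufs uel /eqP E.
have -> : #|V| = size vs.
  by rewrite -(card_uniqP vs_uniq); apply: eq_card => v; rewrite vs_all.
have -> : #|faces M| = size fs.
  rewrite (eq_card facesE) -(size_map (fun c : seq (V * V) => [set z in c])).
  (* Different lists give different faces: a shared dart is allowed by [polyhedral_check] for equal
     lists only. *)
  apply/card_uniqP; rewrite map_inj_in_uniq // => c c' cfs cfs' /setP cc'.
  have := allP (allP polyP c cfs) c' cfs'; case/orP=> [/eqP//|/andP[/hasP H _]].
  case/and3P: facesP => /allP/(_ _ cfs)/and4P[sc _ _ _] _ _.
  case: c sc cc' H {cfs} => // d c _ /(_ d); rewrite !inE eqxx /= => dc' [].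
  by exists d; rewrite ?inE ?eqxx.
rewrite E -(card_uniqP uel).
have elE d : (d \in edge_list) = (d \in darts M) && (rk d.1 < rk d.2).
  rewrite mem_filter andbC dartsE; congr (_ && _).
  apply/allpairsPdep/idP => [[v [w [_ vw ->]]] //|].
  by case: d => v w /= vw; exists v, w.
have -> : edges_of (darts M) = [set [set d.1; d.2] | d in edge_list].
  apply/setP=> A; apply/imsetP/imsetP=> [[d dM ->]|[d dl ->]]; last first.
    by exists d => //; move: dl; rewrite elE => /andP[].
  have dn : rk d.1 != rk d.2.
    apply/eqP=> /rk_inj dd; move: dM; rewrite dartsE -dd.
    by rewrite (negPf (nb_irr _)).
  case: (ltngtP (rk d.1) (rk d.2)) dn => // rd _.
    by exists d; rewrite ?elE ?dM.
  exists (d.2, d.1); last by rewrite setUC.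
  by rewrite elE /= rd andbT dartsE /= -nb_sym -dartsE.
rewrite card_in_imset // => -[v w] [v' w'] /=.
rewrite !elE /= => /andP[_ r1] /andP[_ r2] /setP S.
move: (S v) (S w); rewrite !inE !eqxx orbT => /esym/orP vE /esym/orP wE.
case: vE r1 => /eqP->; case: wE => /eqP-> r1 //; try by rewrite ltnn in r1.
by have := ltn_trans r1 r2; rewrite ltnn.
Qed.

Lemma rotation_map_torus (v0 : V) : torus_map M.
Proof.
rewrite /torus_map simpleM rotationM (connectedM v0) closedM polyhedralM.
exact: eulerM.
Qed.

Lemma rotation_map_semi_equivelar : semi_equivelar [:: 3; 3; 3; 4; 4] M.
Proof.
apply/forallP=> v; apply/exists_inP.
case/and3P: facesP => _ /allP/(_ _ (vs_all v))/allP has_c.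
move=> /allP/(_ _ (vs_all v))/eqP E.
case Env: (nb v) E => [//|w l] E.
have wv : w \in nb v by rewrite Env inE eqxx.
exists w; first by rewrite nbE.
rewrite /face_sizes orbitM // {1}Env /= eqxx rot0 -E -Env; apply/orP; left.
apply/eqP/eq_in_map => u /has_c hc.
have fu : face_at (v, u) \in fs by rewrite mem_nth // -has_find.
by rewrite (face_of_list fu) ?card_verts //; apply: (nth_find [::] hc).
Qed.
End RotationMap.

(** * An isomorphism invariant *)

Section Walks.
Variable V : finType.
Implicit Types (F : {set {set V}}) (u v : V).

(* In a polyhedral map the vertices common to a [p]-gon and a [q]-gon are the
   ends of an edge; so [closed_walks] depends on the face sets only. *)
Definition shares_edge F (pq : nat * nat) u v := (u != v) &&
  [exists A in F, exists B in F, [&& A != B, #|A| == pq.1, #|B| == pq.2,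
     u \in A, v \in A, u \in B & v \in B]].

Fixpoint walks F (w : seq (nat * nat)) u v : nat :=
  if w is pq :: w' then \sum_(z | shares_edge F pq u z) walks F w' z v
  else u == v.

Definition closed_walks F w := \sum_v walks F w v v.

Lemma shares_edge_perm F (f : {perm V}) pq u v :
  shares_edge [set f @: A | A : {set V} in F] pq (f u) (f v) =
  shares_edge F pq u v.
Proof.
rewrite /shares_edge (inj_eq perm_inj); congr (_ && _).
have im_inj : injective (fun A : {set V} => f @: A) by apply/imset_inj/perm_inj.
apply/exists_inP/exists_inP=> [[_ /imsetP[A AF ->]]|[A AF]] /exists_inP[].
  move=> _ /imsetP[B BF ->]; rewrite (inj_eq im_inj).
  rewrite !card_imset ?(mem_imset _ _ perm_inj); try exact: perm_inj.
  by move=> H; exists A => //; apply/exists_inP; exists B.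
move=> B BF H; exists (f @: A); first exact: imset_f.
apply/exists_inP; exists (f @: B); first exact: imset_f.
rewrite (inj_eq im_inj) !card_imset ?(mem_imset _ _ perm_inj) //;
exact: perm_inj.
Qed.

Lemma walks_perm F (f : {perm V}) w u v :
  walks [set f @: A | A : {set V} in F] w (f u) (f v) = walks F w u v.
Proof.
elim: w u => [|pq w IH] u /=; first by rewrite (inj_eq perm_inj).
rewrite (reindex_inj (@perm_inj _ f)); apply: eq_big => z.
  exact: shares_edge_perm.
by rewrite IH.
Qed.

Lemma closed_walks_isomorphic (M1 M2 : embedding V) w : isomorphic M1 M2 ->
  closed_walks (face_vertex_sets M1) w = closed_walks (face_vertex_sets M2) w.
Proof.
case/existsP=> f /eqP <-; rewrite /closed_walks.
rewrite [RHS](reindex_inj (@perm_inj _ f)).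
by apply: eq_bigr => v _; rewrite walks_perm.
Qed.

Variables (vs : seq V) (fs : seq (seq V)).

Definition shares_edge_list (pq : nat * nat) u v := (u != v) &&
  let fuv := [seq c <- fs | (u \in c) && (v \in c)] in
  has (fun c => (size c == pq.1) &&
    has (fun c' => (c != c') && (size c' == pq.2)) fuv) fuv.

Fixpoint walks_list (w : seq (nat * nat)) u v : nat :=
  if w is pq :: w' then
    foldr (fun z m =>
      (if shares_edge_list pq u z then walks_list w' z v else 0) + m) 0 vs
  else u == v.

Definition closed_walks_list w := foldr (fun v m => walks_list w v v + m) 0 vs.

Hypotheses (vs_uniq : uniq vs) (vs_all : forall v, v \in vs).
Hypothesis fs_uniq : all uniq fs.
Hypothesis fs_inj : {in fs &, forall c c', c =i c' -> c = c'}.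
Variable F : {set {set V}}.
Hypothesis fsE : F =i [seq [set v in c] | c <- fs].

Lemma shares_edge_listE pq u v : shares_edge F pq u v = shares_edge_list pq u v.
Proof.
have sz (c : seq V) : c \in fs -> #|[set v in c]| = size c.
  by move=> cfs; rewrite cardsE; apply/card_uniqP/(allP fs_uniq).
have neq (c c' : seq V) : c \in fs -> c' \in fs ->
    ([set v in c] != [set v in c']) = (c != c').
  move=> cfs cfs'; congr (~~ _); apply/eqP/eqP=> [/setP E|-> //].
  by apply: fs_inj => // z; have := E z; rewrite !inE.
rewrite /shares_edge /shares_edge_list; congr (_ && _).
apply/exists_inP/hasP=> [[A]|[c]].
  rewrite fsE => /mapP[c cfs ->] /exists_inP[B]; rewrite fsE => /mapP[c' cfs' ->].
  rewrite neq // !sz // !inE => /and5P[cc' c1 c2 uc /and3P[vc uc' vc']].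
  exists c; first by rewrite mem_filter uc vc.
  by rewrite c1; apply/hasP; exists c'; rewrite ?mem_filter ?uc' ?vc' ?cc'.
rewrite mem_filter => /andP[/andP[uc vc] cfs] /andP[c1 /hasP[c']].
rewrite mem_filter => /andP[/andP[uc' vc'] cfs'] /andP[cc' c2].
exists [set v in c]; first by rewrite fsE map_f.
apply/exists_inP; exists [set v in c']; first by rewrite fsE map_f.
by rewrite neq // !sz // !inE cc' c1 c2 uc vc uc'.
Qed.

Lemma sum_foldr (f : V -> nat) : \sum_v f v = foldr (fun v m => f v + m) 0 vs.
Proof.
have -> : \sum_v f v = \sum_(v <- vs) f v.
  apply/perm_big/uniq_perm; rewrite ?index_enum_uniq // => v.
  by rewrite mem_index_enum vs_all.
by elim: vs => [|v s IH]; rewrite ?big_nil // big_cons IH.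
Qed.

Lemma walks_listE w u v : walks F w u v = walks_list w u v.
Proof.
elim: w u => [|pq w IH] u //=; rewrite big_mkcond sum_foldr.
by elim: vs => //= z s ->; rewrite shares_edge_listE IH.
Qed.

Lemma closed_walks_listE w : closed_walks F w = closed_walks_list w.
Proof.
rewrite /closed_walks sum_foldr /closed_walks_list.
by elim: vs => //= v s ->; rewrite walks_listE.
Qed.
End Walks.

(** * The quotient of the tiling by a lattice *)

Section Models.
Variables n r s k : nat.
Local Notation V := 'I_n.+1.

(* The vertex [x ^ c (b ^ j (a ^ i v0))] is numbered [(2 * j + c) * r + i]. *)
Definition vertex c j i : V := inZp ((2 * j + c) * r + i).
Definition coords (v : V) := (odd (v %/ r), (v %/ r)./2, v %% r).

(** [x] inverts [a], so for [c = 1] the exponent [i] decreases; adding [r.-1] subtracts 1 modulo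
    [r]. *)
Definition model_a (v : V) : V :=
  let: (c, j, i) := coords v in
  vertex c j ((if c then i + r.-1 else i.+1) %% r).
Definition model_aV (v : V) : V :=
  let: (c, j, i) := coords v in
  vertex c j ((if c then i.+1 else i + r.-1) %% r).
Definition model_x (v : V) : V :=
  let: (c, j, i) := coords v in vertex (~~ c) j i.
(** For [c = 1] the half turns cancel and [j] increases; for [c = 0] it decreases. Wrapping around
    uses [b ^+ s = a ^+ k] in either direction. *)
Definition model_bx (v : V) : V :=
  let: (c, j, i) := coords v in
  if c then if j.+1 == s then vertex 0 0 ((i + k) %% r) else vertex 0 j.+1 i
  else if j == 0 then vertex 1 s.-1 ((i + (r - k)) %% r) else vertex 1 j.-1 i.

(** Starting at spoke 2 makes the preceding corners read 3, 3, 3, 4, 4. *)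
Definition model_nbhd v := let w := model_bx v in
  [:: w; model_a w; model_aV v; model_x v; model_a v].
Definition model_map := rotation_map model_nbhd.

Definition vertices : seq V := [seq inZp m | m <- iota 0 n.+1].
Definition quad_list v := [:: v; model_a v; model_x (model_a v); model_x v].
Definition triangle_list v := [:: v; model_bx v; model_a v].
Definition boundary (c : seq V) := zip c (rot 1 c).
(* Each quadrangle is listed once, from its corners [v] with [c = 0]. *)
Definition model_faces :=
  [seq boundary (quad_list v) | v : V <- vertices & ~~ odd (v %/ r)] ++
  [seq boundary (triangle_list v) | v <- vertices].

Definition map_check := [&& graph_check vertices model_nbhd val,
  faces_check vertices model_nbhd model_faces, polyhedral_check model_faces
  & euler_check vertices model_nbhd model_faces val].

Definition same_elements (T : eqType) (c c' : seq T) :=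
  all (fun z => z \in c') c && all (fun z => z \in c) c'.

Definition face_lists := [seq corners c | c <- model_faces].

Definition face_lists_check := let fs := face_lists in
  [&& all (fun c => has (fun v => same_elements c (quad_list v) ||
        same_elements c (triangle_list v)) vertices) fs,
      all (fun v => has (fun c => same_elements c (quad_list v)) fs &&
        has (fun c => same_elements c (triangle_list v)) fs) vertices,
      all uniq fs
    & all (fun c : seq V => all (fun c' : seq V =>
        (c == c') || ~~ all (mem c') c) fs) fs].

(** A relation rather than a function, so that swapping its arguments describes the inverse of [b],
    needed for [c = 0]. *)
Definition b_step (p p' : nat * nat) :=
  (p'.1 == p.1.+1) && (p'.2 == p.2) ||
  [&& p.1.+1 == s, p'.1 == 0 & p'.2 == (p.2 + k) %% r].

Definition coords_check :=
  all (fun v => let: (c, j, i) := coords v in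
    [&& (let: (c', j', i') := coords (model_a v) in
         [&& c' == c, j' == j
           & if c then i'.+1 %% r == i else i.+1 %% r == i']),
        coords (model_x v) == (~~ c, j, i)
      & (let: (c', j', i') := coords (model_bx v) in (c' == ~~ c) &&
         if c then b_step (j, i) (j', i') else b_step (j', i') (j, i))])
    vertices &&
  all (fun c : bool => all (fun j => all (fun i =>
     coords (vertex c j i) == (c, j, i)) (iota 0 r)) (iota 0 s)) [:: true; false].

Definition model_spokes (pq : nat * nat) v : seq V :=
  if pq == (3, 3) then [:: model_bx v; model_a (model_bx v)]
  else if pq == (3, 4) then [:: model_a v; model_aV v] else [:: model_x v].

Definition letters := [:: (3, 3); (3, 4); (4, 4)].
Definition spokes_check := let fs := face_lists in all (fun pq => all (fun v =>
  perm_eq [seq z <- vertices | shares_edge_list fs pq v z] (model_spokes pq v))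
  vertices) letters.

(** Branching over one or two known spokes instead of all vertices keeps the evaluation small;
    [spokes_check] justifies it. *)
Fixpoint spoke_walks (w : seq (nat * nat)) u v : nat :=
  if w is pq :: w' then
    foldr (fun z m => spoke_walks w' z v + m) 0 (model_spokes pq u)
  else u == v.

Definition spoke_closed_walks w :=
  foldr (fun v m => spoke_walks w v v + m) 0 vertices.

Definition model_check :=
  [&& 2 < r, 0 < s, uniq vertices, map_check, face_lists_check, coords_check
    & spokes_check].

Hypothesis checkP : model_check.

Let r_gt0 : 0 < r.
Proof. by case/andP: checkP => r2 _; apply: ltn_trans r2. Qed.
Let s_gt0 : 0 < s. Proof. by case/and3P: checkP. Qed.
Let vs_uniq : uniq vertices. Proof. by case/and4P: checkP. Qed.
Let map_ok : map_check. Proof. by case/and5P: checkP. Qed.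
Let faces_ok : face_lists_check.
Proof. by case/and5P: checkP => _ _ _ _ /and3P[]. Qed.
Let coords_ok : coords_check.
Proof. by case/and5P: checkP => _ _ _ _ /and3P[]. Qed.
Let spokes_ok : spokes_check.
Proof. by case/and5P: checkP => _ _ _ _ /and3P[]. Qed.

Let vs_all v : v \in vertices.
Proof. by apply/mapP; exists (val v); rewrite ?mem_iota ?valZpK /=. Qed.

Lemma model_map_torus : torus_map model_map.
Proof.
case/and4P: map_ok => h1 h2 h3 h4.
exact: (rotation_map_torus vs_uniq vs_all val_inj h1 h2 h3 h4 ord0).
Qed.

Lemma model_map_semi_equivelar : semi_equivelar [:: 3; 3; 3; 4; 4] model_map.
Proof.
case/and4P: map_ok => h1 h2 h3 h4.
exact: (rotation_map_semi_equivelar vs_all h1 h2).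
Qed.

Lemma model_face_vertex_sets :
  face_vertex_sets model_map =i [seq [set v in c] | c <- face_lists].
Proof.
case/and4P: map_ok => h1 h2 h3 h4 A.
by rewrite (rotation_map_face_vertex_sets vs_all h1 h2) /face_lists -map_comp.
Qed.

Lemma model_face_vertex_setsE : face_vertex_sets model_map =
  [set [set z in quad_list v] | v : V] :|:
  [set [set z in triangle_list v] | v : V].
Proof.
have same_set (c c' : seq V) : same_elements c c' ->
    [set z in c] = [set z in c'].
  by case/andP=> /allP cc' /allP c'c; apply/setP=> z; rewrite !inE;
     apply/idP/idP; [apply: cc' | apply: c'c].
case/and4P: faces_ok => /allP fsub /allP fsup _ _.
apply/setP=> A; rewrite model_face_vertex_sets; apply/mapP/setUP.
  case=> c /fsub/hasP[v _ /orP[]/same_set E] ->; [left | right];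
  by rewrite E; apply: imset_f.
by case=> /imsetP[v _ ->];
  case/andP: (fsup v (vs_all v)) => /hasP[c cf E] /hasP[c' cf' E'];
  [exists c; rewrite ?(same_set _ _ E) | exists c'; rewrite ?(same_set _ _ E')].
Qed.

Lemma closed_walks_model w : all (mem letters) w ->
  closed_walks (face_vertex_sets model_map) w = spoke_closed_walks w.
Proof.
case/and4P: faces_ok => _ _ fsu /allP fsi wl.
rewrite (closed_walks_listE vs_uniq vs_all fsu _ model_face_vertex_sets);
  last first.
  move=> c c' cf cf' E; have /allP/(_ _ cf') := fsi c cf.
  case/orP=> [/eqP // | /allP[]].
  by move=> z; rewrite /= E.
rewrite /closed_walks_list /spoke_closed_walks.
have foldrE (f : V -> nat) l :
    foldr (fun z m => f z + m) 0 l = \sum_(z <- l) f z.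
  by elim: l => [|z l IH]; rewrite ?big_nil // big_cons -IH.
suff E u v : walks_list vertices face_lists w u v = spoke_walks w u v.
  by rewrite !foldrE; apply: eq_bigr => v _; rewrite E.
elim: w wl u => // pq w IH /andP[pql wl] u.
have /allP/(_ _ (vs_all u)) P := allP spokes_ok pq pql.
transitivity (\sum_(z <- vertices)
  if shares_edge_list face_lists pq u z
  then walks_list vertices face_lists w z v else 0).
  exact: foldrE.
rewrite -big_mkcond /= foldrE -(perm_big _ P) big_filter.
by apply: eq_bigr => z _; apply: IH.
Qed.

(** Sending coordinates to normal forms intertwines the steps of the model with [a], [x] and [b]
    after [x]. The faces are written in these steps, so they correspond. *)
Lemma model_isomorphic (M : embedding V) a b x :
  strip_lattice (face_vertex_sets M) r s k a b x -> isomorphic model_map M.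
Proof.
case=> act ar bs cardV; pose v0 : V := ord0.
pose g v := let: (c, j, i) := coords v in (x ^+ c)%g (shift a b i j v0).
have gE v c j i : coords v = (c, j, i) -> g v = (x ^+ c)%g (shift a b i j v0).
  by rewrite /g => ->.
case/andP: coords_ok => /allP cv /allP surjv.
have xE v : g (model_x v) = x (g v).
  have := cv v (vs_all v); case Ev: (coords v) => [[c j] i].
  case/and3P=> _ /eqP E _; rewrite (gE _ _ _ _ E) (gE _ _ _ _ Ev).
  by case: c {Ev E}; rewrite /= ?expg0 ?expg1 ?perm1 ?(strip_xx act).
have half h v : translation a b x h -> h (x v) = x (h^-1%g v).
  by move=> trh; rewrite (translation_half_turn _ (translationV trh)) invgK.
have shift_mod i j : shift a b (i %% r) j = shift a b i j.
  by rewrite /shift expg_mod.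
have aS i j v : a (shift a b i j v) = shift a b i.+1 j v.
  have -> : shift a b i.+1 j = (shift a b i j * shift a b 1 0)%g.
    by rewrite (shiftM act) addn1 addn0.
  by rewrite [RHS]permM /shift expg0 expg1 mulg1.
have bS i j i' j' v : b_step (j, i) (j', i') ->
    b (shift a b i j v) = shift a b i' j' v.
  rewrite -permM /shift -mulgA -expgSr.
  case/orP=> /= [/andP[/eqP-> /eqP->] // | /and3P[/eqP js /eqP-> /eqP->]].
  by rewrite js bs -expgD expg0 mulg1 expg_mod.
have aE v : g (model_a v) = a (g v).
  case Ev: (coords v) => [[c j] i].
  case Ev': (coords (model_a v)) => [[c' j'] i'].
  have := cv v (vs_all v); rewrite Ev Ev' => /and3P[+ _ _].
  case/and3P=> /eqP cc' /eqP jj'.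
  rewrite (gE _ _ _ _ Ev) (gE _ _ _ _ Ev') cc' jj'.
  case: (c) => /eqP E; rewrite ?expg0 ?expg1 ?perm1.
    rewrite half; last exact: translation_a act.
    by rewrite -E shift_mod -aS permK.
  by rewrite aS -E shift_mod.
have bxE v : g (model_bx v) = b (x (g v)).
  case Ev: (coords v) => [[c j] i].
  case Ev': (coords (model_bx v)) => [[c' j'] i'].
  have := cv v (vs_all v); rewrite Ev Ev' => /and3P[_ _].
  case/andP=> /eqP cc'; rewrite (gE _ _ _ _ Ev) (gE _ _ _ _ Ev') cc'.
  case: (c) => E; rewrite ?expg0 ?expg1 ?perm1.
    by rewrite (strip_xx act) (bS _ _ _ _ _ E).
  rewrite half; last exact: translation_b act.
  by rewrite -(bS _ _ _ _ _ E) permK.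
have g_surj v : exists u, g u = v.
  have [i [j [c ->]]] := shift_trans act v0 v.
  have [i' [j' [ir js ->]]] := shift_norm i j r_gt0 s_gt0 ar bs.
  exists (vertex c j' i'); apply: gE; apply/eqP.
  have cin : c \in [:: true; false] by case: (c).
  have /allP/(_ j') := surjv c cin; rewrite mem_iota => /(_ js).
  by move/allP/(_ i'); rewrite mem_iota => /(_ ir).
(* [g] maps a finite set onto itself, hence is injective. *)
have g_inj : injective g.
  have /image_injP inj : #|image g V| == #|V|.
    apply/eqP/eq_card => v; have [u <-] := g_surj v.
    by rewrite !inE; apply: codom_f.
  by move=> u v; apply: inj.
pose f := perm g_inj; have fE v : f v = g v by rewrite permE.
have fl (l : seq V) : f @: [set z in l] = [set z in map f l].
  apply/setP=> z; rewrite inE; apply/imsetP/mapP=> -[u ul ->]; exists u => //.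
    by rewrite inE in ul.
  by rewrite inE.
have fq v : f @: [set z in quad_list v] = quad a x (f v).
  apply/setP=> z; rewrite fl /quad !inE /= !fE !xE aE.
  by rewrite -!orbA; do 2 congr (_ || _); apply: orbC.
have ft v : f @: [set z in triangle_list v] = triangle a b x (f v).
  apply/setP=> z; rewrite fl /triangle !inE /= !fE bxE aE.
  by rewrite -!orbA; congr (_ || _); apply: orbC.
apply/existsP; exists f; rewrite (strip_faces act) model_face_vertex_setsE.
rewrite imsetU -!imset_comp; apply/eqP; congr (_ :|: _).
  apply/setP=> A; apply/imsetP/imsetP=> -[v _ ->] /=.
    by exists (f v); rewrite ?fq.
  by have [u <-] := g_surj v; exists u; rewrite //= fq fE.
apply/setP=> A; apply/imsetP/imsetP=> -[v _ ->] /=.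
  by exists (f v); rewrite ?ft.
by have [u <-] := g_surj v; exists u; rewrite //= ft fE.
Qed.
End Models.

(** * Counting the classes *)

(** [ts] is a transversal, so taking classes maps it bijectively onto the partition. *)
Lemma card_equivalence_partition (T : finType) (R : rel T) (D : {set T})
    (ts : seq T) :
  reflexive R -> symmetric R -> transitive R -> uniq ts ->
  {subset ts <= D} -> {in ts &, forall t t', R t t' -> t = t'} ->
  (forall u, u \in D -> exists2 t, t \in ts & R t u) ->
  #|equivalence_partition R D| = size ts.
Proof.
move=> Rrefl Rsym Rtr uts tsD Rinj cover; pose cls u := [set v in D | R u v].
have clsE u v : R u v -> cls u = cls v.
  move=> uv; apply/setP=> z; rewrite !inE; congr (_ && _).
  by apply/idP/idP; apply: Rtr; rewrite // Rsym.
rewrite -(size_map cls); have /card_uniqP <- : uniq (map cls ts).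
  rewrite map_inj_in_uniq // => t t' tts tts' /setP/(_ t').
  by rewrite !inE tsD // Rrefl /= => /Rinj; apply.
apply: eq_card => A; apply/imsetP/mapP=> [[u /cover[t tts tu] ->]|[t tts ->]].
  by exists t => //; apply/esym/clsE.
by exists t; rewrite ?tsD.
Qed.

(** Crossing [q] and then [t] applies [b] or [a * b], and crossing [h] applies [a] or its inverse. A
    walk with [m] blocks [q; t] therefore closes when [b ^+ m] is a certain small power of [a]; the
    three words have [m] equal to 1, 2 and 3. *)
Definition walk_words : seq (seq (nat * nat)) :=
  let t := (3, 3) in let h := (3, 4) in let q := (4, 4) in
  [:: [:: h; h; q; t]; [:: q; t; q; t]; [:: h; h; q; t; q; t; q; t]].

Definition representatives_check n (ps : seq (nat * nat * nat)) :=
  all (fun p => model_check n p.1.1 p.1.2 p.2) ps &&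
  uniq [seq [seq spoke_closed_walks n p.1.1 p.1.2 p.2 w | w <- walk_words]
       | p <- ps].

(** The divisibility alternative is the reflection exchanging [k] and [-k-s] modulo [r]. *)
Definition cover_check m (ps : seq (nat * nat * nat)) :=
  all (fun r => all (fun s => all (fun k =>
    [&& 2 * r * s == m, 2 < r & (s != 1) || (1 < k < r - 2)] ==>
    has (fun p => [&& p.1.1 == r, p.1.2 == s &
                      (p.2 == k) || (r %| k + p.2 + s)]) ps)
  (iota 0 r)) (iota 0 m.+1)) (iota 0 m.+1).

Lemma cover_checkP (V : finType) (M : embedding V) (v0 : V) ps :
  torus_map M -> semi_equivelar [:: 3; 3; 3; 4; 4] M -> cover_check #|V| ps ->
  exists2 p, p \in ps &
  exists a b x, strip_lattice (face_vertex_sets M) p.1.1 p.1.2 p.2 a b x.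
Proof.
move=> tM sM cov; have [a [b [x act]]] := strip_action_exists tM sM.
have [r [s [k [r2 s0 kr ks lat]]]] := strip_lattice_exists v0 act.
have [_ _ _ cardV] := lat.
have rV : r \in iota 0 #|V|.+1 by rewrite mem_iota cardV; nia.
have sV : s \in iota 0 #|V|.+1 by rewrite mem_iota cardV; nia.
have := allP (allP (allP cov r rV) s sV) k; rewrite mem_iota => /(_ kr).
have -> : [&& 2 * r * s == #|V|, 2 < r & (s != 1) || (1 < k < r - 2)].
  by rewrite cardV eqxx r2 /=; case: eqP => // /ks.
case/hasP=> p pps /and3P[/eqP pr /eqP ps' pk]; exists p => //; rewrite pr ps'.
case/orP: pk => [/eqP->|/strip_lattice_mirror/(_ lat)]; first by exists a, b, x.
by exists a^-1%g, (a * b)%g, x.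
Qed.

Lemma num_classes_representatives n ps :
  representatives_check n ps -> cover_check n.+1 ps ->
  num_classes [:: 3; 3; 3; 4; 4] n.+1 = size ps.
Proof.
case/andP=> /allP modelP usig cov; pose model p := model_map n p.1.1 p.1.2 p.2.
pose walks_of p := [seq spoke_closed_walks n p.1.1 p.1.2 p.2 w | w <- walk_words].
have sig p w : p \in ps -> w \in walk_words ->
    closed_walks (face_vertex_sets (model p)) w =
    spoke_closed_walks n p.1.1 p.1.2 p.2 w.
  move=> pps ww; apply: closed_walks_model; first exact: modelP.
  by move: w ww; apply/allP.
have iso_inj : {in ps &, forall p p', isomorphic (model p) (model p') -> p = p'}.
  move=> p p' pps pps' iso.
  have : walks_of p = walks_of p'.
    by apply/eq_in_map => w ww; rewrite -!sig // (closed_walks_isomorphic w iso).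
  case/(nthP p): (pps) => i ips <-; case/(nthP p): (pps') => i' ips' <-.
  rewrite -!(nth_map p [::] walks_of) // => /eqP.
  by rewrite nth_uniq ?size_map // => /eqP->.
rewrite -(size_map model); apply: card_equivalence_partition.
- exact: isomorphic_refl.
- exact: isomorphic_sym.
- exact: isomorphic_trans.
- rewrite map_inj_in_uniq ?(map_uniq usig) // => p p' pps pps' E.
  by apply: iso_inj => //; rewrite E isomorphic_refl.
- move=> _ /mapP[p pps ->]; rewrite inE.
  rewrite (model_map_torus (modelP p pps)).
  by rewrite (model_map_semi_equivelar (modelP p pps)).
- move=> _ _ /mapP[p pps ->] /mapP[p' pps' ->] iso.
  by rewrite (iso_inj p p').
move=> M; rewrite inE => /andP[tM sM].
have cov' : cover_check #|'I_n.+1| ps by rewrite card_ord.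
have [p pps [a [b [x lat]]]] := cover_checkP ord0 tM sM cov'.
exists (model p); first exact: map_f.
by apply: model_isomorphic lat; apply: modelP.
Qed.

(** The empty graph has no component, whereas connectedness asks for exactly one. *)
Lemma num_classes0 s : num_classes s 0 = 0.
Proof.
apply/eqP; rewrite cards_eq0; apply/eqP/setP=> A; rewrite inE.
apply/imsetP=> -[M]; rewrite inE => /andP[/and3P[_ _ /andP[+ _]] _].
by rewrite /connected_graph /n_comp_mem eq_card0 // => -[].
Qed.

Theorem theorem1p4 :
  let N := num_classes [:: 3; 3; 3; 4; 4] in
  N 10 = 1 /\ N 12 = 3 /\ N 14 = 2 /\ N 16 = 5 /\ N 18 = 5 /\ N 20 = 6 /\
  N 22 = 4 /\
  (forall n : nat, n <= 22 -> n \notin [:: 10; 12; 14; 16; 18; 20; 22] ->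
     N n = 0).
Proof.
(* For each factorization [n = 2 * r * s] with [r > 2], the lists contain one admissible [k] from
   every pair exchanged by the reflection. *)
pose p r s k : nat * nat * nat := (r, s, k).
split; first by apply: (@num_classes_representatives 9 [:: p 5 1 2]); vm_compute.
split; first by apply: (@num_classes_representatives 11
  [:: p 3 2 0; p 3 2 2; p 6 1 2]); vm_compute.
split; first by apply: (@num_classes_representatives 13
  [:: p 7 1 2; p 7 1 3]); vm_compute.
split; first by apply: (@num_classes_representatives 15
  [:: p 4 2 0; p 4 2 1; p 4 2 3; p 8 1 2; p 8 1 3]); vm_compute.
split; first by apply: (@num_classes_representatives 17
  [:: p 3 3 0; p 3 3 1; p 9 1 2; p 9 1 3; p 9 1 4]); vm_compute.
split; first by apply: (@num_classes_representatives 19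
  [:: p 5 2 0; p 5 2 1; p 5 2 4; p 10 1 2; p 10 1 3; p 10 1 4]); vm_compute.
split; first by apply: (@num_classes_representatives 21
  [:: p 11 1 2; p 11 1 3; p 11 1 4; p 11 1 5]); vm_compute.
case=> [|n] n22 nexc; first exact: num_classes0.
apply: (@num_classes_representatives n [::]) => //.
(* For the remaining positive [n], covering by the empty list means that no parameters are
   admissible. *)
have : all (fun m =>
  (m \in [:: 10; 12; 14; 16; 18; 20; 22]) || cover_check m [::]) (iota 0 23).
  by vm_compute.
by move/allP/(_ n.+1); rewrite mem_iota (negPf nexc) /= => /(_ n22).
Qed.
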